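(* Let $A$ be a unital $C^*$-algebra and let $a,b\in A$ be normal. Then $a=b$ if and only if $\rho(a,b)=0$. In particular, two normal elements of a $C^*$-algebra are equal if and only if they are quasinilpotent equivalent, i.e. $d_\rho(a,b)=0$.
   Context: For $a,b\in A$ and $n\geq 0$ put $C_{a,b}^n\mathbf 1=\sum_{k=0}^n(-1)^k\binom{n}{k}a^{n-k}b^k$ (with $a^0=b^0=\mathbf 1$). Define $\rho(a,b)=\limsup_{n\to\infty}\|C_{a,b}^n\mathbf 1\|^{1/n}$ and $d_\rho(a,b)=\max\{\rho(a,b),\rho(b,a)\}$. *)

(* Defs.v *)
From Stdlib Require Import Reals Lra.
Open Scope R_scope.

Definition Cx : Type := (R * R)%type.
Definition Cadd (z w : Cx) : Cx := (fst z + fst w, snd z + snd w).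
Definition Cmul (z w : Cx) : Cx :=
  (fst z * fst w - snd z * snd w, fst z * snd w + snd z * fst w).
Definition Cconj (z : Cx) : Cx := (fst z, - snd z).
Definition Cmod (z : Cx) : R := sqrt (fst z ^ 2 + snd z ^ 2).
Definition Cone : Cx := (1, 0).
Definition RtoC (r : R) : Cx := (r, 0).

Record CStarAlgebra : Type := {
  car :> Type;
  zero : car; one : car;
  add : car -> car -> car; opp : car -> car; mul : car -> car -> car;
  smul : Cx -> car -> car; star : car -> car; norm : car -> R;
  add_assoc : forall x y z, add x (add y z) = add (add x y) z;
  add_comm : forall x y, add x y = add y x;
  add_0l : forall x, add zero x = x;
  add_opp : forall x, add x (opp x) = zero;
  mul_assoc : forall x y z, mul x (mul y z) = mul (mul x y) z;
  mul_1l : forall x, mul one x = x;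
  mul_1r : forall x, mul x one = x;
  mul_addl : forall x y z, mul (add x y) z = add (mul x z) (mul y z);
  mul_addr : forall x y z, mul x (add y z) = add (mul x y) (mul x z);
  smul_assoc : forall c d x, smul c (smul d x) = smul (Cmul c d) x;
  smul_1 : forall x, smul Cone x = x;
  smul_addC : forall c d x, smul (Cadd c d) x = add (smul c x) (smul d x);
  smul_add : forall c x y, smul c (add x y) = add (smul c x) (smul c y);
  smul_mull : forall c x y, smul c (mul x y) = mul (smul c x) y;
  smul_mulr : forall c x y, smul c (mul x y) = mul x (smul c y);
  star_invol : forall x, star (star x) = x;
  star_add : forall x y, star (add x y) = add (star x) (star y);
  star_mul : forall x y, star (mul x y) = mul (star y) (star x);
  star_smul : forall c x, star (smul c x) = smul (Cconj c) (star x);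
  norm_eq0 : forall x, norm x = 0 <-> x = zero;
  norm_triangle : forall x y, norm (add x y) <= norm x + norm y;
  norm_smul : forall c x, norm (smul c x) = Cmod c * norm x;
  norm_submult : forall x y, norm (mul x y) <= norm x * norm y;
  norm_complete : forall u : nat -> car,
    (forall eps, eps > 0 -> exists N, forall m n, (m >= N)%nat -> (n >= N)%nat ->
        norm (add (u m) (opp (u n))) < eps) ->
    exists l, forall eps, eps > 0 -> exists N, forall n, (n >= N)%nat ->
        norm (add (u n) (opp l)) < eps;
  cstar_id : forall x, norm (mul (star x) x) = norm x * norm x
}.

Arguments zero {_}. Arguments one {_}. Arguments add {_}. Arguments opp {_}.
Arguments mul {_}. Arguments smul {_}. Arguments star {_}. Arguments norm {_}.

Definition is_normal {A : CStarAlgebra} (a : A) : Prop :=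
  mul a (star a) = mul (star a) a.

Fixpoint apow {A : CStarAlgebra} (x : A) (n : nat) : A :=
  match n with O => one | S n => mul x (apow x n) end.

Fixpoint asum {A : CStarAlgebra} (f : nat -> A) (n : nat) : A :=
  match n with O => f O | S n => add (asum f n) (f (S n)) end.

Definition Cab {A : CStarAlgebra} (a b : A) (n : nat) : A :=
  asum (fun k => smul (RtoC ((-1) ^ k * Binomial.C n k))
                      (mul (apow a (n - k)) (apow b k))) n.

Definition nroot (x : R) (n : nat) : R :=
  if Req_EM_T x 0 then 0 else Rpower x (/ INR n).

Definition is_limsup (u : nat -> R) (l : R) : Prop :=
  forall eps, eps > 0 ->
    (exists N, forall n, (n >= N)%nat -> u n < l + eps) /\
    (forall N, exists n, (n >= N)%nat /\ l - eps < u n).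

Definition rho_is {A : CStarAlgebra} (a b : A) (l : R) : Prop :=
  is_limsup (fun n => nroot (norm (Cab a b n)) n) l.

(* Main.v *)
(* Write [h], [k] for the real parts of [a], [b].  The Taylor coefficients of [exp (t a) exp (-t b)]
   are [C_{a,b}^n 1 / n!], so [rho(a,b) = 0] says that this function has exponential type 0.  By
   normality, [exp (t a)] is the product of a unitary and [exp (t h)] and similarly for [b], so
   [g(t) = ||exp (t h) exp (-t k)||] grows subexponentially on the real line.  For self-adjoint
   [p], [q] one has [||p q||^2 <= ||p^2 q^2||], hence [g(t)^2 <= g(2t)], and therefore [g <= 1].
   Then [exp (-t k) exp (2 t h) exp (-t k)] and its inverse are self-adjoint contractions, hence
   equal, and comparing first-order terms in [t] gives [h = k].  The same argument for [i a], [i b]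
   gives the equality of the imaginary parts. *)
Require Import Defs.
From Stdlib Require Import Reals Lra Lia Factorial IndefiniteDescription.
From Stdlib Require Ncring Ncring_tac.
From Coquelicot Require Series.
Open Scope R_scope.

(* Notation and the noncommutative ring tactic *)
Declare Scope cstar_scope.
Delimit Scope cstar_scope with A.
Notation "0" := zero : cstar_scope.
Notation "1" := one : cstar_scope.
Notation "x + y" := (add x y) : cstar_scope.
Notation "- x" := (opp x) : cstar_scope.
Notation "x - y" := (add x (opp y)) : cstar_scope.
Notation "x * y" := (mul x y) : cstar_scope.
Notation "r *: x" := (smul (RtoC r) x) (at level 40) : cstar_scope.
Notation "x ^*" := (star x) (at level 2, format "x ^*") : cstar_scope.

(** Subtraction is [add x (opp y)], the very term behind the notation [x - y], and equality is
    Leibniz, so identities proved by [nc_ring] can be used for rewriting. *)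
#[local] Instance cstar_ring_ops (A : CStarAlgebra) : @Ncring.Ring_ops A zero one add mul (fun x y => add x (opp y)) opp eq := {}.
#[local] Instance cstar_ring (A : CStarAlgebra) : @Ncring.Ring _ _ _ _ _ _ _ _ (cstar_ring_ops A).
Proof.
  split; unfold Algebra_syntax.equality, Ncring.eq_notation.
  - exact RelationClasses.eq_equivalence.
  - intros x y -> z w ->. reflexivity.
  - intros x y -> z w ->. reflexivity.
  - intros x y -> z w ->. reflexivity.
  - intros x y ->. reflexivity.
  - exact (add_0l A).
  - exact (add_comm A).
  - exact (add_assoc A).
  - exact (mul_1l A).
  - exact (mul_1r A).
  - exact (mul_assoc A).
  - exact (mul_addl A).
  - intros x y z; exact (mul_addr A z x y).
  - reflexivity.
  - exact (add_opp A).
Qed.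

Ltac nc_ring := Ncring_tac.non_commutative_ring.

(** * Elementary consequences of the axioms *)

Section Basics.
Context {A : CStarAlgebra}.
Implicit Types (x y z u v w : A) (r s t : R).

Lemma Cmod_RtoC r : Cmod (RtoC r) = Rabs r.
Proof.
  unfold Cmod, RtoC; simpl.
  replace (r * (r * 1) + 0 * (0 * 1)) with (Rsqr r) by (unfold Rsqr; ring).
  apply sqrt_Rsqr_abs.
Qed.

Lemma rscal_mul r s x : (r *: (s *: x))%A = ((r * s)%R *: x)%A.
Proof. rewrite smul_assoc; f_equal; unfold Cmul, RtoC; simpl; f_equal; ring. Qed.

Lemma rscal_addl r s x : ((r + s)%R *: x)%A = (r *: x + s *: x)%A.
Proof. rewrite <- smul_addC; f_equal; unfold Cadd, RtoC; simpl; f_equal; ring. Qed.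

Lemma rscal_1 x : (1%R *: x)%A = x.
Proof. apply smul_1. Qed.

Lemma norm_rscal r x : norm (r *: x)%A = Rabs r * norm x.
Proof. now rewrite norm_smul, Cmod_RtoC. Qed.

Lemma add_cancel x y z : (x + z = y + z)%A -> x = y.
Proof.
  intros H. replace x with (x + z - z)%A by nc_ring.
  rewrite H. nc_ring.
Qed.

Lemma sub_eq0 x y : (x - y = 0)%A -> x = y.
Proof. intros H; apply (add_cancel _ _ (- y)%A); rewrite H; nc_ring. Qed.

Lemma smul_0 c : smul c (zero : A) = zero.
Proof.
  apply (add_cancel _ _ (smul c zero)). rewrite <- smul_add.
  replace (0 + 0)%A with (zero : A) by nc_ring. nc_ring.
Qed.

Lemma rscal_0 x : (0%R *: x)%A = 0%A.
Proof.
  apply (add_cancel _ _ (0%R *: x)%A). rewrite <- rscal_addl.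
  rewrite Rplus_0_r. nc_ring.
Qed.

Lemma smul_opp c x : smul c (- x)%A = (- smul c x)%A.
Proof.
  apply (add_cancel _ _ (smul c x)). rewrite <- smul_add.
  replace (- x + x)%A with (zero : A) by nc_ring. rewrite smul_0. nc_ring.
Qed.

Lemma rscal_N r x : ((- r)%R *: x)%A = (- (r *: x))%A.
Proof.
  apply (add_cancel _ _ (r *: x)%A). rewrite <- rscal_addl.
  replace (- r + r) with 0 by ring. rewrite rscal_0. nc_ring.
Qed.

Lemma opp_rscal x : (- x)%A = ((-1)%R *: x)%A.
Proof. replace (-1) with (- (1)) by ring. now rewrite rscal_N, rscal_1. Qed.

Lemma rscal_inj r x y : r <> 0 -> (r *: x = r *: y)%A -> x = y.
Proof.
  intros Hr H. rewrite <- (rscal_1 x), <- (rscal_1 y).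
  replace 1 with (/ r * r) by (field; assumption).
  rewrite <- !rscal_mul. now rewrite H.
Qed.

Lemma norm_0 : norm (zero : A) = 0.
Proof. now apply norm_eq0. Qed.

Lemma norm_opp x : norm (- x)%A = norm x.
Proof. rewrite opp_rscal, norm_rscal, Rabs_left; lra. Qed.

(** Not an axiom: it follows from [0 = norm (x - x) <= 2 * norm x]. *)
Lemma norm_ge0 x : 0 <= norm x.
Proof.
  pose proof (norm_triangle A x (- x)%A) as H.
  rewrite add_opp, norm_0, norm_opp in H. lra.
Qed.

Lemma norm_sub_triangle x y z : norm (x - z)%A <= norm (x - y)%A + norm (y - z)%A.
Proof.
  replace (x - z)%A with ((x - y) + (y - z))%A by nc_ring. apply norm_triangle.
Qed.

Lemma norm_subC x y : norm (x - y)%A = norm (y - x)%A.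
Proof. rewrite <- norm_opp; f_equal; nc_ring. Qed.

Lemma star_1 : star (one : A) = one.
Proof.
  transitivity (star (star one * one : A)%A).
  - now rewrite star_mul, star_invol, mul_1r.
  - now rewrite mul_1r, star_invol.
Qed.

(** [norm one] equals its own square. The zero algebra is allowed, so equality with 1 can fail. *)
Lemma norm_1_le : norm (one : A) <= 1.
Proof.
  pose proof (cstar_id A one) as H. rewrite star_1, mul_1l in H.
  pose proof (norm_ge0 (one : A)). nra.
Qed.

Lemma star_0 : star (zero : A) = zero.
Proof.
  apply (add_cancel _ _ (star zero)). rewrite <- star_add.
  replace (0 + 0)%A with (zero : A) by nc_ring. nc_ring.
Qed.

Lemma star_opp x : star (- x)%A = (- star x)%A.
Proof.
  apply (add_cancel _ _ (star x)). rewrite <- star_add.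
  replace (- x + x)%A with (zero : A) by nc_ring. rewrite star_0. nc_ring.
Qed.

Lemma star_rscal r x : star (r *: x)%A = (r *: star x)%A.
Proof.
  rewrite star_smul; f_equal; unfold Cconj, RtoC; simpl; f_equal; ring.
Qed.

(** The C*-identity and submultiplicativity give [norm y ^ 2 <= norm (star y) * norm y]; this is
    applied to [x] and to [star x]. *)
Lemma norm_star x : norm (star x) = norm x.
Proof.
  assert (H : forall y, norm y <= norm (star y)).
  { intros y. pose proof (cstar_id A y) as H1.
    pose proof (norm_submult A (star y) y) as H2.
    pose proof (norm_ge0 y). pose proof (norm_ge0 (star y)). nra. }
  pose proof (H x). pose proof (H (star x)) as H2. rewrite star_invol in H2. lra.
Qed.

Lemma norm_mul_le x y r s : norm x <= r -> norm y <= s -> norm (x * y)%A <= r * s.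
Proof.
  intros Hx Hy. eapply Rle_trans; [apply norm_submult|].
  apply Rmult_le_compat; auto using norm_ge0.
Qed.

(** * Finite sums *)

Lemma asum_ext (f g : nat -> A) n :
  (forall k, (k <= n)%nat -> f k = g k) -> asum f n = asum g n.
Proof.
  induction n as [|n IH]; intros H; simpl; [apply H; lia|].
  rewrite IH, (H (S n)); auto.
Qed.

Lemma asum_add (f g : nat -> A) n :
  asum (fun k => f k + g k)%A n = (asum f n + asum g n)%A.
Proof. induction n as [|n IH]; simpl; [reflexivity|]. rewrite IH. nc_ring. Qed.

Lemma asum_opp (f : nat -> A) n : asum (fun k => - f k)%A n = (- asum f n)%A.
Proof. induction n as [|n IH]; simpl; [reflexivity|]. rewrite IH. nc_ring. Qed.

Lemma asum_mull x (f : nat -> A) n : asum (fun k => x * f k)%A n = (x * asum f n)%A.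
Proof. induction n as [|n IH]; simpl; [reflexivity|]. rewrite IH. nc_ring. Qed.

Lemma asum_smul c (f : nat -> A) n : asum (fun k => smul c (f k)) n = smul c (asum f n).
Proof. induction n as [|n IH]; simpl; [reflexivity|]. now rewrite IH, smul_add. Qed.

Lemma asum_rscall (f : nat -> R) x n :
  asum (fun k => f k *: x)%A n = (sum_f_R0 f n *: x)%A.
Proof. induction n as [|n IH]; simpl; [reflexivity|]. now rewrite IH, rscal_addl. Qed.

Lemma asum_star (f : nat -> A) n : star (asum f n) = asum (fun k => star (f k)) n.
Proof. induction n as [|n IH]; simpl; [reflexivity|]. now rewrite star_add, IH. Qed.

Lemma asum_recl (f : nat -> A) n :
  asum f (S n) = (f O + asum (fun k => f (S k)) n)%A.
Proof.
  induction n as [|n IH]; [reflexivity|].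
  change (asum f (S (S n))) with (asum f (S n) + f (S (S n)))%A.
  rewrite IH; simpl. nc_ring.
Qed.

Lemma norm_asum (f : nat -> A) (g : nat -> R) n :
  (forall k, (k <= n)%nat -> norm (f k) <= g k) -> norm (asum f n) <= sum_f_R0 g n.
Proof.
  induction n as [|n IH]; intros H; simpl; [apply H; lia|].
  eapply Rle_trans; [apply norm_triangle|].
  apply Rplus_le_compat; auto.
Qed.

Lemma norm_asum_tail (f : nat -> A) (g : nat -> R) m n :
  (forall k, norm (f k) <= g k) -> (m <= n)%nat ->
  norm (asum f n - asum f m)%A <= sum_f_R0 g n - sum_f_R0 g m.
Proof.
  intros H Hmn. induction Hmn as [|n Hmn IH].
  - replace (asum f m - asum f m)%A with (zero : A) by nc_ring. rewrite norm_0. lra.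
  - simpl. replace (asum f n + f (S n) - asum f m)%A
      with ((asum f n - asum f m) + f (S n))%A by nc_ring.
    eapply Rle_trans; [apply norm_triangle|]. specialize (H (S n)). lra.
Qed.

(** * Convergence *)

Definition tends (u : nat -> A) (l : A) : Prop := Un_cv (fun n => norm (u n - l)%A) 0.

Lemma Un_cv_squeeze0 (u v : nat -> R) :
  (forall n, 0 <= u n <= v n) -> Un_cv v 0 -> Un_cv u 0.
Proof.
  intros H Hv eps He. destruct (Hv eps He) as [N HN]. exists N. intros n Hn.
  specialize (HN n Hn). specialize (H n). unfold Rdist in *.
  rewrite Rminus_0_r in *. rewrite Rabs_pos_eq in * by lra. lra.
Qed.

Lemma tends_squeeze (u : nat -> A) l (v : nat -> R) :
  (forall n, norm (u n - l)%A <= v n) -> Un_cv v 0 -> tends u l.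
Proof.
  intros H Hv. apply (Un_cv_squeeze0 _ v); auto. intros n; split; auto using norm_ge0.
Qed.

Lemma Un_cv_const r : Un_cv (fun _ => r) r.
Proof. intros eps He. exists O. intros n _. unfold Rdist. rewrite Rminus_diag, Rabs_R0. lra. Qed.

Lemma Un_cv_eq (u v : nat -> R) l l' : (forall n, u n = v n) -> l = l' -> Un_cv u l -> Un_cv v l'.
Proof. intros H <- Hu eps He. destruct (Hu eps He) as [N HN]. exists N. intros n Hn. rewrite <- H. auto. Qed.

Lemma tends_ext (u v : nat -> A) l : (forall n, u n = v n) -> tends u l -> tends v l.
Proof. intros H. apply Un_cv_eq; auto. intros n; now rewrite H. Qed.

Lemma tends_const x : tends (fun _ => x) x.
Proof.
  apply (tends_squeeze _ _ (fun _ => 0)); [|apply Un_cv_const].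
  intros _. rewrite add_opp, norm_0. lra.
Qed.

Lemma tends_add (u v : nat -> A) x y :
  tends u x -> tends v y -> tends (fun n => u n + v n)%A (x + y)%A.
Proof.
  intros Hu Hv. eapply tends_squeeze.
  2:{ eapply Un_cv_eq; [| |exact (CV_plus _ _ _ _ Hu Hv)]; [intros; reflexivity|ring]. }
  intros n; simpl.
  replace (u n + v n - (x + y))%A with ((u n - x) + (v n - y))%A by nc_ring.
  apply norm_triangle.
Qed.

Lemma tends_mul (u v : nat -> A) x y :
  tends u x -> tends v y -> tends (fun n => u n * v n)%A (x * y)%A.
Proof.
  intros Hu Hv. eapply tends_squeeze.
  2:{ eapply Un_cv_eq; [| |exact (CV_plus _ _ _ _
        (CV_mult _ _ _ _ Hu (CV_plus _ _ _ _ Hv (Un_cv_const (norm y))))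
        (CV_mult _ _ _ _ (Un_cv_const (norm x)) Hv))]; [intros; reflexivity|ring]. }
  intros n; simpl.
  (* Writing [v n] as [v n - y + y] bounds its norm without a separate boundedness argument. *)
  replace (u n * v n - x * y)%A with ((u n - x) * (v n - y + y) + x * (v n - y))%A by nc_ring.
  eapply Rle_trans; [apply norm_triangle|]. apply Rplus_le_compat.
  - apply norm_mul_le; [lra|apply norm_triangle].
  - apply norm_submult.
Qed.

Lemma tends_star (u : nat -> A) x : tends u x -> tends (fun n => star (u n)) (star x).
Proof.
  apply Un_cv_eq; auto. intros n.
  now rewrite <- star_opp, <- star_add, norm_star.
Qed.

Lemma norm_tends_le (u : nat -> A) x r :
  (forall n, norm (u n) <= r) -> tends u x -> norm x <= r.
Proof.
  intros H Hu. apply Rnot_lt_le; intros Hlt.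
  destruct (Hu (norm x - r)) as [N HN]; [lra|]. specialize (HN N (le_n N)).
  unfold Rdist in HN. rewrite Rminus_0_r, Rabs_pos_eq in HN by apply norm_ge0.
  pose proof (norm_triangle A (u N) (x - u N)%A) as H1.
  replace (u N + (x - u N))%A with x in H1 by nc_ring.
  rewrite norm_subC in H1. specialize (H N). lra.
Qed.

Lemma tends_unique (u : nat -> A) x y : tends u x -> tends u y -> x = y.
Proof.
  intros Hx Hy. apply sub_eq0, norm_eq0.
  apply Rle_antisym; [|apply norm_ge0].
  apply Rnot_lt_le; intros Hlt.
  destruct (Hx (norm (x - y)%A / 2)) as [N HN]; [lra|].
  destruct (Hy (norm (x - y)%A / 2)) as [M HM]; [lra|].
  specialize (HN (N + M)%nat ltac:(lia)). specialize (HM (N + M)%nat ltac:(lia)).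
  unfold Rdist in *. rewrite Rminus_0_r, Rabs_pos_eq in * by apply norm_ge0.
  pose proof (norm_sub_triangle x (u (N + M)%nat) y) as H.
  rewrite (norm_subC x (u _)) in H. lra.
Qed.

(** The Weierstrass test: tails are dominated by those of the real series, and the algebra is
    complete. *)
Lemma asum_converges (f : nat -> A) (g : nat -> R) l :
  (forall n, norm (f n) <= g n) -> infinite_sum g l -> exists x, tends (asum f) x.
Proof.
  intros H Hg.
  destruct (norm_complete A (asum f)) as [x Hs].
  - intros eps He. destruct (Hg (eps / 2)) as [N HN]; [lra|]. exists N. intros m n Hm Hn.
    assert (Hle : forall p q, (p >= N)%nat -> (p <= q)%nat ->
      norm (asum f q - asum f p)%A < eps).
    { intros p q Hp Hpq. eapply Rle_lt_trans; [apply (norm_asum_tail f g); auto|].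
      pose proof (HN p Hp) as H1. pose proof (HN q ltac:(lia)) as H2. unfold Rdist in *.
      apply Rabs_def2 in H1. apply Rabs_def2 in H2. lra. }
    destruct (Nat.le_ge_cases m n); [rewrite norm_subC|]; auto.
  - exists x. intros eps He. destruct (Hs eps He) as [N HN]. exists N. intros n Hn.
    unfold Rdist. rewrite Rminus_0_r, Rabs_pos_eq by apply norm_ge0. auto.
Qed.

(** * Cauchy products *)

(** Both sides sum [x i * y k] over the triangle [i + k <= n]; the right-hand side collects the
    terms by [k]. *)
Lemma asum_triangle (x y : nat -> A) n :
  asum (fun m => asum (fun k => x (m - k)%nat * y k)%A m) n
  = asum (fun k => asum x (n - k) * y k)%A n.
Proof.
  induction n as [|n IH]; [reflexivity|].
  change (asum (fun m => asum (fun k => x (m - k)%nat * y k)%A m) (S n))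
    with (asum (fun m => asum (fun k => x (m - k)%nat * y k)%A m) n
          + (asum (fun k => x (S n - k)%nat * y k)%A n + x (S n - S n)%nat * y (S n)))%A.
  rewrite IH.
  change (asum (fun k => asum x (S n - k) * y k)%A (S n))
    with (asum (fun k => asum x (S n - k) * y k)%A n + asum x (S n - S n) * y (S n))%A.
  rewrite (asum_ext (fun k => asum x (S n - k) * y k)%A
     (fun k => asum x (n - k) * y k + x (S n - k)%nat * y k)%A).
  - rewrite asum_add, Nat.sub_diag. simpl (asum x 0). nc_ring.
  - intros k Hk. rewrite Nat.sub_succ_l by exact Hk. simpl. nc_ring.
Qed.

Lemma sum_triangle (x y : nat -> R) n :
  sum_f_R0 (fun m => sum_f_R0 (fun k => x (m - k)%nat * y k) m) n
  = sum_f_R0 (fun k => sum_f_R0 x (n - k) * y k) n.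
Proof.
  induction n as [|n IH]; [reflexivity|].
  change (sum_f_R0 (fun m => sum_f_R0 (fun k => x (m - k)%nat * y k) m) (S n))
    with (sum_f_R0 (fun m => sum_f_R0 (fun k => x (m - k)%nat * y k) m) n
          + (sum_f_R0 (fun k => x (S n - k)%nat * y k) n + x (S n - S n)%nat * y (S n))).
  rewrite IH. rewrite (tech5 (fun k => sum_f_R0 x (S n - k) * y k)).
  rewrite Nat.sub_diag. simpl (sum_f_R0 x 0).
  rewrite (sum_eq (fun k => sum_f_R0 x (S n - k) * y k)
     (fun k => sum_f_R0 x (n - k) * y k + x (S n - k)%nat * y k)).
  - rewrite sum_plus. ring.
  - intros k Hk. rewrite Nat.sub_succ_l by exact Hk. simpl. ring.
Qed.

(** The product of the partial sums X_n and Y_n minus the triangular sum is the sum of (X_n -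
    X_{n-k}) y_k. It is dominated by the same expression in [f] and [g], which tends to 0 by the
    product theorem for real series. *)
Lemma cauchy_product (x y : nat -> A) (f g : nat -> R) X Y lf lg :
  (forall n, norm (x n) <= f n) -> (forall n, norm (y n) <= g n) ->
  infinite_sum f lf -> infinite_sum g lg ->
  tends (asum x) X -> tends (asum y) Y ->
  tends (asum (fun m => asum (fun k => x (m - k)%nat * y k)%A m)) (X * Y)%A.
Proof.
  intros Hx Hy Hf Hg HX HY.
  assert (f0 : forall n, 0 <= f n) by (intros n; eapply Rle_trans; [apply norm_ge0|apply Hx]).
  assert (g0 : forall n, 0 <= g n) by (intros n; eapply Rle_trans; [apply norm_ge0|apply Hy]).
  assert (Hfg : Un_cv (fun n => sum_f_R0 f n * sum_f_R0 g n
      - sum_f_R0 (fun m => sum_f_R0 (fun k => f (m - k)%nat * g k) m) n) 0).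
  { replace 0 with (lf * lg - lg * lf) by ring.
    apply CV_minus; [apply CV_mult; assumption|].
    (* [is_series_mult] attaches the summation index to its first series, hence the order [g],
       [f]. *)
    pose proof (Series.is_series_mult g f lg lf) as H.
    rewrite !Series.is_series_Reals in H. specialize (H Hg Hf).
    assert (Habs : forall (u : nat -> R) l, (forall n, 0 <= u n) -> infinite_sum u l ->
      Series.ex_series (K := Hierarchy.R_AbsRing) (V := Hierarchy.R_NormedModule)
        (fun n => Rabs (u n))).
    { intros u l u0 Hu. exists l.
      eapply Series.is_series_ext; [intros n; symmetry; apply Rabs_pos_eq, u0|].
      now apply Series.is_series_Reals. }
    specialize (H (Habs _ _ g0 Hg) (Habs _ _ f0 Hf)).
    eapply Un_cv_eq; [|reflexivity|exact H].
    intros n. apply sum_eq. intros m _. apply sum_eq. intros; ring. }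
  replace (X * Y)%A with (X * Y + 0)%A by nc_ring.
  eapply (tends_ext (fun n => asum x n * asum y n
    + (asum (fun m => asum (fun k => x (m - k)%nat * y k)%A m) n - asum x n * asum y n))%A).
  { intros n; nc_ring. }
  apply tends_add; [apply tends_mul; assumption|].
  eapply tends_squeeze; [|exact Hfg]. intros n; cbv beta.
  rewrite asum_triangle, sum_triangle, <- asum_mull.
  replace (asum (fun k => asum x (n - k) * y k)%A n - asum (fun k => asum x n * y k)%A n - 0)%A
    with (- (asum (fun k => asum x n * y k)%A n + - asum (fun k => asum x (n - k) * y k)%A n))%A
    by nc_ring.
  rewrite norm_opp, <- asum_opp, <- asum_add.
  rewrite scal_sum, <- minus_sum. apply norm_asum. intros k Hk.
  replace (asum x n * y k - asum x (n - k) * y k)%A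
    with ((asum x n - asum x (n - k)) * y k)%A by nc_ring.
  replace (g k * sum_f_R0 f n - sum_f_R0 f (n - k) * g k)
    with ((sum_f_R0 f n - sum_f_R0 f (n - k)) * g k) by ring.
  apply norm_mul_le; [apply norm_asum_tail; [exact Hx|lia]|apply Hy].
Qed.

End Basics.

(** * The exponential function and its link with [Cab] *)

Section Exponential.
Context {A : CStarAlgebra}.
Implicit Types (x y z a b : A) (r s t : R).

Fixpoint Cpow (c : Cx) (n : nat) : Cx :=
  match n with O => Cone | S n => Cmul c (Cpow c n) end.

Lemma Cmod_mul c d : Cmod (Cmul c d) = Cmod c * Cmod d.
Proof.
  unfold Cmod, Cmul; simpl. rewrite <- sqrt_mult by nra. f_equal. ring.
Qed.

Lemma Cmod_pow c n : Cmod (Cpow c n) = Cmod c ^ n.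
Proof.
  induction n as [|n IH]; simpl.
  - change Cone with (RtoC 1). rewrite Cmod_RtoC. apply Rabs_R1.
  - now rewrite Cmod_mul, IH.
Qed.

Lemma Cmul_comm c d : Cmul c d = Cmul d c.
Proof. unfold Cmul; f_equal; ring. Qed.

Lemma Cmul_assoc c d e : Cmul c (Cmul d e) = Cmul (Cmul c d) e.
Proof. unfold Cmul; simpl; f_equal; ring. Qed.

Lemma Cmul_1l c : Cmul Cone c = c.
Proof. destruct c; unfold Cmul, Cone; simpl; f_equal; ring. Qed.

Lemma RtoC_mul r s : Cmul (RtoC r) (RtoC s) = RtoC (r * s).
Proof. unfold Cmul, RtoC; simpl; f_equal; ring. Qed.

Lemma Cpow_RtoC r n : Cpow (RtoC r) n = RtoC (r ^ n).
Proof. induction n as [|n IH]; simpl; [reflexivity|]. now rewrite IH, RtoC_mul. Qed.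

Lemma Cpow_add c m n : Cpow c (m + n) = Cmul (Cpow c m) (Cpow c n).
Proof.
  induction m as [|m IH]; simpl; [now rewrite Cmul_1l|]. now rewrite IH, Cmul_assoc.
Qed.

Lemma smul_mul_smul c d x y : (smul c x * smul d y)%A = smul (Cmul c d) (x * y)%A.
Proof. now rewrite <- smul_mull, <- smul_mulr, smul_assoc. Qed.

Lemma rscal_mul_rscal r s x y : (r *: x * (s *: y))%A = ((r * s)%R *: (x * y))%A.
Proof. now rewrite smul_mul_smul, RtoC_mul. Qed.

Lemma smul_inj c d x y : Cmul d c = Cone -> smul c x = smul c y -> x = y.
Proof.
  intros Hd H. rewrite <- (smul_1 A x), <- (smul_1 A y), <- Hd, <- !smul_assoc.
  now rewrite H.
Qed.

Lemma apow_smul c x n : apow (smul c x) n = smul (Cpow c n) (apow x n).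
Proof.
  induction n as [|n IH]; simpl; [now rewrite smul_1|]. now rewrite IH, smul_mul_smul.
Qed.

Lemma apow_add x m n : apow x (m + n) = (apow x m * apow x n)%A.
Proof.
  induction m as [|m IH]; simpl; [now rewrite mul_1l|]. now rewrite IH, mul_assoc.
Qed.

Lemma apow_commute x y n : (x * y = y * x)%A -> (apow x n * y = y * apow x n)%A.
Proof.
  intros H. induction n as [|n IH]; simpl.
  - now rewrite mul_1l, mul_1r.
  - now rewrite <- mul_assoc, IH, !mul_assoc, H.
Qed.

Lemma star_apow x n : star (apow x n) = apow (star x) n.
Proof.
  induction n as [|n IH]; simpl; [apply star_1|].
  rewrite star_mul, IH. now apply apow_commute.
Qed.

Lemma norm_apow x n : norm (apow x n) <= norm x ^ n.
Proof.
  induction n as [|n IH]; simpl; [apply norm_1_le|]. apply norm_mul_le; lra.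
Qed.

Definition eterm x (n : nat) : A := (/ INR (fact n) *: apow x n)%A.

Lemma norm_eterm x n : norm (eterm x n) <= / INR (fact n) * norm x ^ n.
Proof.
  unfold eterm. pose proof (INR_fact_lt_0 n). pose proof (Rinv_0_lt_compat _ H).
  rewrite norm_rscal, Rabs_pos_eq by lra.
  apply Rmult_le_compat_l; [lra|apply norm_apow].
Qed.

Lemma infinite_sum_exp r : infinite_sum (fun n => / INR (fact n) * r ^ n) (exp r).
Proof. exact (proj2_sig (exist_exp r)). Qed.

Lemma eterm_converges x : exists e, tends (asum (eterm x)) e.
Proof.
  exact (asum_converges _ _ _ (norm_eterm x) (infinite_sum_exp (norm x))).
Qed.

(** Completeness gives a mere existence statement, so the limit is named by choice; later arguments
    see it through [aexp_tends]. *)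
Definition aexp x : A :=
  proj1_sig (constructive_indefinite_description _ (eterm_converges x)).

Lemma aexp_tends x : tends (asum (eterm x)) (aexp x).
Proof. exact (proj2_sig (constructive_indefinite_description _ (eterm_converges x))). Qed.

Lemma aexp_mul_tends x y :
  tends (asum (fun m => asum (fun k => eterm x (m - k) * eterm y k)%A m))
        (aexp x * aexp y)%A.
Proof.
  apply (cauchy_product _ _ _ _ _ _ _ _ (norm_eterm x) (norm_eterm y)
    (infinite_sum_exp _) (infinite_sum_exp _)); apply aexp_tends.
Qed.

(** This recurrence takes the place of binomial coefficients in [eterm_add]. *)
Lemma eterm_S x n : (INR (S n) *: eterm x (S n))%A = (x * eterm x n)%A.
Proof.
  unfold eterm. rewrite rscal_mul, <- smul_mulr. simpl apow. f_equal. f_equal.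
  rewrite fact_simpl, mult_INR. field. split; [apply INR_fact_neq_0|apply not_0_INR; lia].
Qed.

Lemma eterm_commute x y n : (x * y = y * x)%A -> (eterm x n * y = y * eterm x n)%A.
Proof.
  intros H. unfold eterm. rewrite <- smul_mull, <- smul_mulr. f_equal.
  now apply apow_commute.
Qed.

(** The binomial theorem in divided powers: multiplied by [n + 1 = (n + 1 - k) + k], the convolution
    of degree [n + 1] becomes [x + y] times that of degree [n], by [eterm_S] in each factor. *)
Lemma eterm_add x y n : (x * y = y * x)%A ->
  asum (fun k => eterm x (n - k) * eterm y k)%A n = eterm (x + y)%A n.
Proof.
  intros Hxy. induction n as [|n IH].
  - unfold eterm; simpl. rewrite Rinv_1, !rscal_1. apply mul_1l.
  - apply (rscal_inj (INR (S n))); [apply not_0_INR; lia|].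
    rewrite eterm_S, <- IH, <- asum_smul.
    rewrite (asum_ext _ (fun k => INR (S n - k) *: eterm x (S n - k) * eterm y k
       + eterm x (S n - k) * (INR k *: eterm y k))%A).
    2:{ intros k Hk. rewrite <- smul_mull, <- smul_mulr, <- rscal_addl.
        rewrite minus_INR by exact Hk. f_equal. f_equal. ring. }
    rewrite asum_add, (asum_recl (fun k => eterm x (S n - k) * (INR k *: eterm y k))%A).
    change (asum (fun k => INR (S n - k) *: eterm x (S n - k) * eterm y k)%A (S n))
      with (asum (fun k => INR (S n - k) *: eterm x (S n - k) * eterm y k)%A n
        + INR (S n - S n) *: eterm x (S n - S n) * eterm y (S n))%A.
    (* The last term of the first sum and the first term of the second carry the factor 0. *)
    rewrite Nat.sub_diag, mul_addl, <- !asum_mull. simpl (INR 0). rewrite !rscal_0.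
    rewrite (asum_ext (fun k => INR (S n - k) *: eterm x (S n - k) * eterm y k)%A
      (fun k => x * (eterm x (n - k) * eterm y k))%A).
    2:{ intros k Hk. rewrite Nat.sub_succ_l by exact Hk. rewrite eterm_S. nc_ring. }
    rewrite (asum_ext (fun k => eterm x (S n - S k) * (INR (S k) *: eterm y (S k)))%A
      (fun k => y * (eterm x (n - k) * eterm y k))%A).
    2:{ intros k Hk. rewrite eterm_S, !mul_assoc, <- (eterm_commute x y) by exact Hxy.
        reflexivity. }
    nc_ring.
Qed.

Lemma aexp_add x y : (x * y = y * x)%A -> (aexp x * aexp y)%A = aexp (x + y)%A.
Proof.
  intros H. eapply tends_unique; [apply aexp_mul_tends|].
  eapply tends_ext; [|apply aexp_tends]. intros n. apply asum_ext. intros k _.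
  symmetry. now apply eterm_add.
Qed.

Lemma aexp_0 : aexp 0%A = 1%A.
Proof.
  eapply tends_unique; [apply aexp_tends|].
  eapply tends_ext; [|apply tends_const]. intros n. symmetry.
  assert (H : forall k, eterm (0 : A)%A (S k) = 0%A).
  { intros k. unfold eterm; simpl. replace (0 * apow 0 k)%A with (0 : A)%A by nc_ring.
    apply smul_0. }
  induction n as [|n IH]; simpl.
  - unfold eterm; simpl. now rewrite Rinv_1, rscal_1.
  - rewrite IH, H. nc_ring.
Qed.

Lemma aexp_opp_r x : (aexp x * aexp (- x) = 1)%A.
Proof. rewrite aexp_add by nc_ring. rewrite add_opp. apply aexp_0. Qed.

Lemma aexp_opp_l x : (aexp (- x) * aexp x = 1)%A.
Proof. rewrite aexp_add, add_comm, add_opp by nc_ring. apply aexp_0. Qed.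

Lemma star_aexp x : star (aexp x) = aexp (star x).
Proof.
  eapply tends_unique; [apply tends_star, aexp_tends|].
  eapply tends_ext; [|apply aexp_tends]. intros n. rewrite asum_star.
  apply asum_ext. intros k _. unfold eterm. now rewrite star_rscal, star_apow.
Qed.

(** Every term has total degree [n]. This lets both elements be multiplied by the imaginary unit
    without changing the norms. *)
Lemma Cab_smul c a b n : Cab (smul c a) (smul c b) n = smul (Cpow c n) (Cab a b n).
Proof.
  unfold Cab. rewrite <- asum_smul. apply asum_ext. intros k Hk.
  rewrite !apow_smul, smul_mul_smul, !smul_assoc. f_equal.
  rewrite (Cmul_comm (Cpow c n)). f_equal. rewrite <- Cpow_add. f_equal. lia.
Qed.

(** The powers of [a] already stand to the left of those of [b], so it remains to match scalars: the
    binomial coefficient divided by n! is 1 / ((n-k)! k!). *)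
Lemma asum_eterm_Cab t a b n :
  asum (fun k => eterm (t *: a) (n - k) * eterm (t *: (- b)) k)%A n
  = ((/ INR (fact n) * t ^ n)%R *: Cab a b n)%A.
Proof.
  unfold Cab. rewrite <- asum_smul. apply asum_ext. intros k Hk.
  unfold eterm. rewrite opp_rscal, !apow_smul, !Cpow_RtoC, !rscal_mul, rscal_mul_rscal.
  f_equal. f_equal.
  replace (t ^ n) with (t ^ (n - k) * t ^ k) by (rewrite <- pow_add; f_equal; lia).
  unfold Binomial.C. field. repeat split; apply INR_fact_neq_0.
Qed.

(** Geometric growth of the coefficients at rate [r] bounds the exponential type by [r], through
    termwise comparison with the series of [exp (r * Rabs t)]. *)
Lemma norm_aexp_mul_le a b r K t : 0 <= r ->
  (forall n, norm (Cab a b n) <= K * r ^ n) ->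
  norm (aexp (t *: a) * aexp (t *: (- b)))%A <= K * exp (r * Rabs t).
Proof.
  intros Hr H. eapply norm_tends_le; [|apply aexp_mul_tends]. intros n.
  assert (HK : 0 <= K).
  { specialize (H O). simpl in H. pose proof (norm_ge0 (Cab a b 0)). lra. }
  eapply Rle_trans.
  - apply (norm_asum _ (fun m => / INR (fact m) * (r * Rabs t) ^ m * K)). intros m _.
    rewrite asum_eterm_Cab, norm_rscal.
    pose proof (INR_fact_lt_0 m) as Hf. apply Rinv_0_lt_compat in Hf.
    rewrite Rabs_mult, (Rabs_pos_eq (/ _)), <- RPow_abs, Rpow_mult_distr by lra.
    replace (/ INR (fact m) * (r ^ m * Rabs t ^ m) * K)
      with (/ INR (fact m) * Rabs t ^ m * (K * r ^ m)) by ring.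
    apply Rmult_le_compat_l; [|apply H].
    apply Rmult_le_pos; [lra|apply pow_le, Rabs_pos].
  - rewrite <- scal_sum. apply Rmult_le_compat_l; [exact HK|].
    apply (sum_incr (fun m => / INR (fact m) * (r * Rabs t) ^ m)); [apply infinite_sum_exp|].
    intros m. pose proof (INR_fact_lt_0 m) as Hf. apply Rinv_0_lt_compat in Hf.
    apply Rmult_le_pos; [lra|]. apply pow_le, Rmult_le_pos; [exact Hr|apply Rabs_pos].
Qed.

(** * First-order expansions at 0 *)

(** Says that [f] has value 1 and derivative [x] at 0. A quadratic remainder on [-1, 1] is stable
    under products and avoids differential calculus in [A]. *)
Definition expands (f : R -> A) x : Prop :=
  exists K, forall t, Rabs t <= 1 -> norm (f t - (1 + t *: x))%A <= K * t ^ 2.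

(** From [exp (- r) >= 1 - r] one gets [exp r - 1 <= r * exp r]; using this twice gives the
    bound. *)
Lemma exp_second_order r : 0 <= r -> exp r - (1 + r) <= r ^ 2 * exp r.
Proof.
  intros Hr. pose proof (exp_ineq1_le (- r)) as H. pose proof (exp_pos r) as Hp.
  assert (E : exp r * exp (- r) = 1) by (rewrite <- exp_plus, Rplus_opp_r; apply exp_0).
  assert (exp r * (1 + - r) <= 1) by (rewrite <- E; apply Rmult_le_compat_l; lra).
  nra.
Qed.

Lemma norm_aexp_second_order x :
  norm (aexp x - (1 + x))%A <= exp (norm x) - (1 + norm x).
Proof.
  assert (Hf : forall k, 0 < / INR (fact k)) by (intros k; apply Rinv_0_lt_compat, INR_fact_lt_0).
  (* The shift to [S n] makes every partial sum contain the terms of order 0 and 1. *)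
  eapply (norm_tends_le (fun n => asum (eterm x) (S n) - (1 + x))%A).
  - intros n.
    replace (1 + x)%A with (asum (eterm x) 1).
    2:{ unfold eterm; simpl. now rewrite Rinv_1, !rscal_1, mul_1r. }
    eapply Rle_trans; [apply (norm_asum_tail _ _ 1 (S n) (norm_eterm x)); lia|].
    apply Rplus_le_compat.
    + apply (sum_incr (fun m => / INR (fact m) * norm x ^ m)); [apply infinite_sum_exp|].
      intros m. specialize (Hf m). apply Rmult_le_pos; [lra|apply pow_le, norm_ge0].
    + simpl. lra.
  - apply tends_add; [|apply tends_const].
    intros eps He. destruct (aexp_tends x eps He) as [N HN]. exists N. intros n Hn.
    apply HN. lia.
Qed.

Lemma expands_aexp x : expands (fun t => aexp (t *: x)%A) x.
Proof.
  exists (norm x ^ 2 * exp (norm x)). intros t Ht.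
  eapply Rle_trans; [apply norm_aexp_second_order|].
  eapply Rle_trans; [apply exp_second_order, norm_ge0|].
  rewrite norm_rscal. rewrite Rpow_mult_distr, pow2_abs.
  assert (exp (Rabs t * norm x) <= exp (norm x)).
  { pose proof (norm_ge0 x). pose proof (Rabs_pos t).
    assert (Rabs t * norm x <= norm x) as [H1|H1] by nra.
    - left; now apply exp_increasing.
    - right; now rewrite H1. }
  replace (norm x ^ 2 * exp (norm x) * t ^ 2) with (t ^ 2 * norm x ^ 2 * exp (norm x)) by ring.
  apply Rmult_le_compat_l; [|assumption]. apply Rmult_le_pos; apply pow2_ge_0.
Qed.

Lemma expands_mul f g x y : expands f x -> expands g y ->
  expands (fun t => f t * g t)%A (x + y)%A.
Proof.
  intros [K HK] [L HL].
  assert (K0 : 0 <= K).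
  { specialize (HK 1). rewrite Rabs_R1 in HK. specialize (HK (Rle_refl 1)).
    eapply Rle_trans in HK; [|apply norm_ge0]. lra. }
  assert (L0 : 0 <= L).
  { specialize (HL 1). rewrite Rabs_R1 in HL. specialize (HL (Rle_refl 1)).
    eapply Rle_trans in HL; [|apply norm_ge0]. lra. }
  exists (K * (1 + norm y + L) + (1 + norm x) * L + norm x * norm y). intros t Ht.
  specialize (HK t Ht). specialize (HL t Ht).
  rewrite smul_add. set (X := (t *: x)%A) in *. set (Y := (t *: y)%A) in *.
  assert (HX : norm X = Rabs t * norm x) by apply norm_rscal.
  assert (HY : norm Y = Rabs t * norm y) by apply norm_rscal.
  pose proof (norm_ge0 x) as nx. pose proof (norm_ge0 y) as ny.
  pose proof (Rabs_pos t) as t0. pose proof (@norm_1_le A) as n1.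
  assert (Ht2 : t ^ 2 <= 1) by (rewrite <- pow2_abs; nra).
  assert (Hg : norm (g t) <= 1 + norm y + L).
  { replace (g t) with (1 + Y + (g t - (1 + Y)))%A by nc_ring.
    eapply Rle_trans; [apply norm_triangle|].
    pose proof (norm_triangle A 1%A Y). pose proof (pow2_ge_0 t). nra. }
  assert (H1X : norm (1 + X)%A <= 1 + norm x).
  { eapply Rle_trans; [apply norm_triangle|]. nra. }
  (* The error splits into that of [f], that of [g] and the product of the two linear terms, each of
     order [t ^ 2]. *)
  replace (f t * g t - (1 + (X + Y)))%A
    with ((f t - (1 + X)) * g t + (1 + X) * (g t - (1 + Y)) + X * Y)%A by nc_ring.
  eapply Rle_trans; [apply norm_triangle|].
  rewrite (Rmult_plus_distr_r (_ + _) _ (t ^ 2)), (Rmult_plus_distr_r (K * _) _ (t ^ 2)).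
  apply Rplus_le_compat.
  - eapply Rle_trans; [apply norm_triangle|]. apply Rplus_le_compat.
    + replace (K * (1 + norm y + L) * t ^ 2) with ((K * t ^ 2) * (1 + norm y + L)) by ring.
      now apply norm_mul_le.
    + rewrite Rmult_assoc. now apply norm_mul_le.
  - replace (norm x * norm y * t ^ 2) with (norm X * norm Y)
      by (rewrite HX, HY, <- (pow2_abs t); ring).
    apply norm_submult.
Qed.

Lemma expands_unique f x y : expands f x -> expands f y -> x = y.
Proof.
  intros [K HK] [L HL]. apply sub_eq0, norm_eq0.
  apply Rle_antisym; [|apply norm_ge0]. apply Rnot_lt_le; intros Hlt.
  set (d := norm (x - y)%A) in *.
  assert (H : forall t, 0 < t <= 1 -> d <= (K + L) * t).
  { intros t Ht. assert (Ht1 : Rabs t <= 1) by (rewrite Rabs_pos_eq; lra).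
    specialize (HK t Ht1). specialize (HL t Ht1).
    pose proof (norm_sub_triangle (1 + t *: x) (f t) (1 + t *: y))%A as H.
    rewrite (norm_subC _ (f t)) in H.
    replace (1 + t *: x - (1 + t *: y))%A with (t *: (x - y))%A in H
      by (rewrite smul_add, smul_opp; nc_ring).
    rewrite norm_rscal, Rabs_pos_eq in H by lra. fold d in H. nra. }
  assert (HKL : d <= K + L) by (specialize (H 1 ltac:(lra)); lra).
  (* At this [t] the bound [(K + L) * t] is [d / 2]; [HKL] makes [K + L] positive and this [t] at
     most 1. *)
  specialize (H (d / (2 * (K + L)))).
  assert (E : (K + L) * (d / (2 * (K + L))) = d / 2) by (field; lra).
  rewrite E in H. cut (d <= d / 2); [lra|]. apply H. split.
  - apply Rdiv_lt_0_compat; lra.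
  - apply (Rmult_le_reg_l (K + L)); [lra|]. rewrite E. lra.
Qed.
End Exponential.

(** * Norm inequalities *)

(** If [x > r], dividing by [x ^ n] gives [x <= K * (r / x) ^ n], which tends to 0. Arbitrarily
    large [n] suffice, so the lemma applies along powers of 2. *)
Lemma le_of_pow_le (x K r : R) : 0 <= r ->
  (forall m, exists n, (m <= n)%nat /\ x ^ S n <= K * r ^ n) -> x <= r.
Proof.
  intros Hr H. apply Rnot_lt_le; intros Hlt.
  assert (H1 : 0 <= r / x < 1).
  { split; [apply Rmult_le_pos; [lra|left; apply Rinv_0_lt_compat; lra]|].
    apply (Rmult_lt_reg_r x); [lra|]. unfold Rdiv. rewrite Rmult_assoc, Rinv_l; lra. }
  pose proof (Rabs_pos K) as K0.
  (* [K] may have either sign; [Rabs K + 1] is a positive bound for it. *)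
  destruct (pow_lt_1_zero (r / x)) with (y := x / (Rabs K + 1)) as [N HN].
  - rewrite Rabs_pos_eq; lra.
  - apply Rdiv_lt_0_compat; lra.
  - destruct (H N) as [n [Hn Hx]]. specialize (HN n Hn).
    pose proof (pow_le (r / x) n (proj1 H1)) as Hp. rewrite Rabs_pos_eq in HN by exact Hp.
    assert (Hxn : 0 < x ^ n) by (apply pow_lt; lra).
    assert (E : r ^ n = (r / x) ^ n * x ^ n).
    { rewrite <- Rpow_mult_distr. f_equal. field. lra. }
    rewrite E in Hx. simpl in Hx.
    assert (HK : x <= K * (r / x) ^ n) by nra.
    assert (HK2 : (Rabs K + 1) * (r / x) ^ n < x).
    { apply (Rmult_lt_compat_l (Rabs K + 1)) in HN; [|lra].
      replace ((Rabs K + 1) * (x / (Rabs K + 1))) with x in HN by (field; lra). exact HN. }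
    pose proof (Rle_abs K). nra.
Qed.

(** Puts the exponents [2 ^ m] in the form [S n] required by [le_of_pow_le]. *)
Lemma pow2_pred_succ m : exists n, (m <= n)%nat /\ (2 ^ m)%nat = S n.
Proof.
  exists (2 ^ m - 1)%nat. pose proof (Nat.pow_gt_lin_r 2 m ltac:(lia)). lia.
Qed.

Lemma exp_pow x n : exp x ^ n = exp (INR n * x).
Proof.
  induction n as [|n IH].
  - simpl. now rewrite Rmult_0_l, exp_0.
  - rewrite S_INR, Rmult_plus_distr_r, Rmult_1_l, exp_plus, <- IH. simpl. ring.
Qed.

(* Iterating the hypothesis, [g t <= (g (2^m t)) ^ (1 / 2^m)], and the right-hand side tends to
   at most [exp (eps |t|)]. *)
Lemma le_1_of_doubling (g : R -> R) :
  (forall t, 0 <= g t) -> (forall t, g t ^ 2 <= g (2 * t)) ->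
  (forall eps, eps > 0 -> exists K, forall t, g t <= K * exp (eps * Rabs t)) ->
  forall t, g t <= 1.
Proof.
  intros g0 Hdouble Hgrowth t. apply Rnot_lt_le; intros Hlt.
  assert (Hpow : forall m, g t ^ (2 ^ m) <= g (2 ^ m * t)).
  { induction m as [|m IH].
    - simpl. rewrite Rmult_1_l, Rmult_1_r. lra.
    - replace (2 ^ S m)%nat with (2 ^ m * 2)%nat by (simpl; lia).
      rewrite pow_mult. eapply Rle_trans; [apply pow_incr; split; [|exact IH]|].
      + apply pow_le, g0.
      + eapply Rle_trans; [apply Hdouble|]. right. f_equal. simpl. ring. }
  pose proof (Rabs_pos t) as t0.
  assert (Hln : 0 < ln (g t)) by (rewrite <- ln_1; apply ln_increasing; lra).
  (* Chosen so that [eps * Rabs t < ln (g t)]; adding 1 to [Rabs t] covers [t = 0]. *)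
  set (eps := ln (g t) / (2 * (Rabs t + 1))).
  assert (Heps : eps > 0) by (apply Rdiv_lt_0_compat; lra).
  destruct (Hgrowth eps Heps) as [K HK].
  set (r := exp (eps * Rabs t)).
  assert (Hr : g t <= r).
  (* The factor [r] in the constant accounts for the exponent [S n]. *)
  { apply (le_of_pow_le _ (K * r)); [left; apply exp_pos|].
    intros m. destruct (pow2_pred_succ m) as [n [Hn E]]. exists n. split; [exact Hn|].
    rewrite <- E. eapply Rle_trans; [apply Hpow|]. eapply Rle_trans; [apply HK|].
    right. rewrite Rmult_assoc. f_equal. change (r * r ^ n) with (r ^ S n). rewrite <- E.
    unfold r. rewrite exp_pow. f_equal. rewrite pow_INR. simpl INR.
    rewrite Rabs_mult, (Rabs_pos_eq (2 ^ m)) by (apply pow_le; lra).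
    replace (1 + 1) with 2 by ring. ring. }
  assert (Hlt2 : r < g t).
  { rewrite <- (exp_ln (g t)) by lra. apply exp_increasing. unfold eps.
    apply (Rmult_lt_reg_r (2 * (Rabs t + 1))); [lra|].
    replace (ln (g t) / (2 * (Rabs t + 1)) * Rabs t * (2 * (Rabs t + 1)))
      with (ln (g t) * Rabs t) by (field; lra). nra. }
  lra.
Qed.

Section Inequalities.
Context {A : CStarAlgebra}.
Implicit Types (x y z a b p q h k w : A) (r s t : R).

(** By the C*-identity, squaring a self-adjoint element squares its norm. This stands in for the
    equality of norm and spectral radius. *)
Lemma norm_selfadjoint_pow w m : star w = w -> norm w ^ (2 ^ m) = norm (apow w (2 ^ m)).
Proof.
  intros Hw. induction m as [|m IH].
  - simpl. now rewrite mul_1r, Rmult_1_r.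
  - replace (2 ^ S m)%nat with (2 ^ m + 2 ^ m)%nat by (simpl; lia).
    rewrite pow_add, apow_add, IH, <- cstar_id, star_apow, Hw. reflexivity.
Qed.

(* The left-hand side is the norm of the self-adjoint [q p^2 q], hence its spectral radius,
   which is also the spectral radius of [p^2 q^2]. *)
Lemma norm_mul_sqr_le p q : star p = p -> star q = q ->
  norm (p * q)%A ^ 2 <= norm (p * p * (q * q))%A.
Proof.
  intros Hp Hq.
  set (w := (q * (p * p) * q)%A). set (v := (p * p * (q * q))%A).
  assert (Hw : star w = w) by (unfold w; rewrite !star_mul, Hp, Hq; nc_ring).
  replace (norm (p * q)%A ^ 2) with (norm w).
  2:{ rewrite <- Rsqr_pow2. unfold Rsqr. rewrite <- cstar_id. f_equal.
      unfold w. rewrite star_mul, Hp, Hq. nc_ring. }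
  (* With [s = p * p * q] one has [w = q * s] and [v = s * q], so the factors of a power of [w] can
     be regrouped. *)
  assert (E : forall n, apow w (S n) = (q * apow v n * (p * p * q))%A).
  { induction n as [|n IH].
    - simpl. unfold w. nc_ring.
    - change (apow w (S (S n))) with (w * apow w (S n))%A. rewrite IH.
      simpl. unfold w, v. nc_ring. }
  apply (le_of_pow_le _ (norm q * norm (p * p * q)%A)); [apply norm_ge0|].
  intros m. destruct (pow2_pred_succ m) as [n [Hn E2]]. exists n. split; [exact Hn|].
  rewrite <- E2, norm_selfadjoint_pow, E2, E by exact Hw.
  replace (norm q * norm (p * p * q)%A * norm v ^ n)
    with (norm q * norm v ^ n * norm (p * p * q)%A) by ring.
  apply norm_mul_le; [|apply Rle_refl]. apply norm_mul_le; [apply Rle_refl|apply norm_apow].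
Qed.

(** [norm (x * y) ^ 2] is the norm of [star y * (star x * x) * y], so [x] enters through
    [star x * x] alone; taking adjoints gives the same for [y] and [y * star y]. *)
Lemma norm_mul_abs x y p q :
  (star x * x = star p * p)%A -> (y * star y = q * star q)%A ->
  norm (x * y)%A = norm (p * q)%A.
Proof.
  intros Hx Hy.
  assert (Hl : forall u v w : A, (star u * u = star v * v)%A -> norm (u * w)%A = norm (v * w)%A).
  { intros u v w E. assert (Hsq : norm (u * w)%A ^ 2 = norm (v * w)%A ^ 2).
    { rewrite <- !Rsqr_pow2. unfold Rsqr. rewrite <- !cstar_id. f_equal.
      rewrite !star_mul.
      replace (star w * star u * (u * w))%A with (star w * (star u * u) * w)%A by nc_ring.
      rewrite E. nc_ring. }
    apply Rsqr_inj; auto using norm_ge0. now rewrite !Rsqr_pow2. }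
  rewrite (Hl x p y Hx), <- (norm_star (p * y)%A), <- (norm_star (p * q)%A), !star_mul.
  apply Hl. now rewrite !star_invol.
Qed.

(* 1 is an extreme point of the unit ball: if [S_N] is a sum of [N] independent signs,
   then [x + N y] is the mean of [(x + S_N) u] with [u] products of [1 + y] and [1 - y], and
   [|x + S_N| <= ((x + S_N)^2 / c + c) / 2]. *)
Lemma norm_random_walk_le y c : norm (1 + y)%A <= 1 -> norm (1 - y)%A <= 1 -> 0 < c ->
  forall n r, norm (r *: 1 + INR n *: y)%A <= ((r ^ 2 + INR n) / c + c) / 2.
Proof.
  intros H1 H2 Hc. induction n as [|n IH]; intros r.
  - simpl INR. rewrite rscal_0, add_comm, add_0l, norm_rscal.
    eapply Rle_trans with (Rabs r).
    { pose proof (@norm_1_le A). pose proof (Rabs_pos r). nra. }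
    apply (Rmult_le_reg_r (2 * c)); [lra|].
    replace (((r ^ 2 + 0) / c + c) / 2 * (2 * c)) with (r ^ 2 + c ^ 2) by (field; lra).
    rewrite <- (pow2_abs r). pose proof (pow2_ge_0 (Rabs r - c)). nra.
  (* Conditioning on the first sign: [(r + 1) ^ 2] and [(r - 1) ^ 2] average to [r ^ 2 + 1], which
     supplies the step from [INR n] to [INR (S n)]. *)
  - assert (E : (2%R *: (r *: 1 + INR (S n) *: y))%A =
      ((1 + y) * ((r + 1)%R *: 1 + INR n *: y) + (1 - y) * ((r - 1)%R *: 1 + INR n *: y))%A).
    { rewrite S_INR, !rscal_addl. unfold Rminus. rewrite rscal_addl, rscal_N, !rscal_1.
      replace 2 with (1 + 1) by ring. rewrite rscal_addl, !rscal_1.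
      nc_ring. }
    assert (HN : 2 * norm (r *: 1 + INR (S n) *: y)%A
      <= ((r + 1) ^ 2 + INR n) / c / 2 + c / 2 + (((r - 1) ^ 2 + INR n) / c + c) / 2).
    { rewrite <- (Rabs_pos_eq 2) at 1 by lra. rewrite <- norm_rscal, E.
      eapply Rle_trans; [apply norm_triangle|].
      pose proof (norm_mul_le _ _ _ _ H1 (IH (r + 1))) as HA.
      pose proof (norm_mul_le _ _ _ _ H2 (IH (r - 1))) as HB. lra. }
    replace (((r ^ 2 + INR (S n)) / c + c) / 2)
      with ((((r + 1) ^ 2 + INR n) / c / 2 + c / 2 + (((r - 1) ^ 2 + INR n) / c + c) / 2) / 2).
    + lra.
    + rewrite S_INR. field. lra.
Qed.

Lemma unit_ball_extreme_1 y : norm (1 + y)%A <= 1 -> norm (1 - y)%A <= 1 -> y = 0%A.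
Proof.
  intros H1 H2. apply norm_eq0. apply Rle_antisym; [|apply norm_ge0].
  apply Rnot_lt_le; intros Hlt.
  destruct (INR_unbounded (/ norm y)) as [m Hm].
  assert (Hi : 0 < / norm y) by (apply Rinv_0_lt_compat; lra).
  (* With [m * m] steps and [c = m] the bound reads [m ^ 2 * norm y <= m], impossible once
     [m > / norm y]. *)
  pose proof (norm_random_walk_le y (INR m) H1 H2 ltac:(lra) (m * m) 0) as H.
  rewrite rscal_0, add_0l, norm_rscal, mult_INR, Rabs_pos_eq in H by nra.
  replace (((0 ^ 2 + INR m * INR m) / INR m + INR m) / 2) with (INR m) in H by (field; lra).
  assert (Hmy : 1 < INR m * norm y).
  { apply (Rmult_lt_compat_r (norm y)) in Hm; [|lra]. rewrite Rinv_l in Hm; lra. }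
  nra.
Qed.

(* With [s = p - q] one has [1 + s^2/2 = (p^2 + q^2)/2], so [1 + i s / sqrt 2] and
   [1 - i s / sqrt 2] are contractions. *)
Lemma selfadjoint_contraction_inverse p q :
  star p = p -> star q = q -> (p * q = 1)%A -> (q * p = 1)%A ->
  norm p <= 1 -> norm q <= 1 -> p = q.
Proof.
  intros Hp Hq Hpq Hqp Np Nq.
  assert (Hr : / sqrt 2 * / sqrt 2 = 1 / 2).
  { rewrite <- Rinv_mult, sqrt_def by lra. lra. }
  set (r := / sqrt 2) in *. set (c := (0, r) : Cx). set (y := smul c (p - q)%A).
  assert (Hy : star y = (- y)%A).
  { unfold y. rewrite star_smul, star_add, star_opp, Hp, Hq, (opp_rscal (smul c _)), smul_assoc.
    f_equal. unfold c, Cconj, Cmul, RtoC; simpl. f_equal; ring. }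
  assert (Hyy : (1 - y * y)%A = ((1 / 2)%R *: (p * p + q * q))%A).
  { unfold y. rewrite smul_mul_smul.
    replace (Cmul c c) with (RtoC (- (1 / 2)))
      by (unfold c, Cmul, RtoC; simpl; f_equal; [rewrite Hr; ring|ring]).
    rewrite rscal_N.
    replace ((p - q) * (p - q))%A with (p * p + q * q - p * q - q * p)%A by nc_ring.
    rewrite Hpq, Hqp.
    replace (p * p + q * q - 1 - 1)%A with (p * p + q * q + - (2%R *: 1))%A
      by (replace 2 with (1 + 1) by ring; rewrite rscal_addl, !rscal_1; nc_ring).
    rewrite smul_add, smul_opp, rscal_mul. replace (1 / 2 * 2) with 1 by field.
    rewrite rscal_1. nc_ring. }
  assert (HN : norm (1 - y * y)%A <= 1).
  { rewrite Hyy, norm_rscal, Rabs_pos_eq by lra.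
    pose proof (norm_triangle A (p * p)%A (q * q)%A).
    pose proof (norm_mul_le _ _ _ _ Np Np). pose proof (norm_mul_le _ _ _ _ Nq Nq). lra. }
  assert (y0 : y = 0%A).
  (* Since [y] is skew-adjoint, [1 + y] and [1 - y] both have squared norm [norm (1 - y * y)]. *)
  { apply unit_ball_extreme_1.
    - pose proof (cstar_id A (1 + y)%A) as H. rewrite star_add, star_1, Hy in H.
      replace ((1 + - y) * (1 + y))%A with (1 - y * y)%A in H by nc_ring.
      pose proof (norm_ge0 (1 + y)%A). nra.
    - pose proof (cstar_id A (1 - y)%A) as H. rewrite star_add, star_1, star_opp, Hy in H.
      replace ((1 + - - y) * (1 - y))%A with (1 - y * y)%A in H by nc_ring.
      pose proof (norm_ge0 (1 - y)%A). nra. }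
  apply sub_eq0. apply (smul_inj c (0, - (2 * r))).
  - unfold c, Cmul, Cone; simpl. f_equal; [nra|ring].
  - fold y. now rewrite y0, smul_0.
Qed.

End Inequalities.

(** * Quasinilpotent equivalence *)

(** For nonnegative [u], a root-free form of the statement that the n-th roots of [u n] tend to 0;
    [eps] may be arbitrarily small. *)
Definition subexponential (u : nat -> R) : Prop :=
  forall eps, eps > 0 -> exists K, forall n, u n <= K * eps ^ n.

Lemma bounded_initial (u : nat -> R) N : exists K, forall n, (n <= N)%nat -> u n <= K.
Proof.
  induction N as [|N [K HK]].
  - exists (u O). intros n Hn. replace n with O by lia. lra.
  - exists (Rmax K (u (S N))). intros n Hn.
    destruct (Nat.eq_dec n (S N)) as [->|H]; [apply Rmax_r|].
    eapply Rle_trans; [apply HK; lia|apply Rmax_l].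
Qed.

(** From some [N] on the root is below [eps], so [u n <= eps ^ n]; the finitely many earlier terms
    are absorbed in the constant. *)
Lemma limsup_nroot_subexponential (u : nat -> R) :
  (forall n, 0 <= u n) -> is_limsup (fun n => nroot (u n) n) 0 -> subexponential u.
Proof.
  intros u0 H eps He. destruct (H eps He) as [[N HN] _].
  destruct (bounded_initial (fun n => u n / eps ^ n) N) as [K HK].
  exists (Rmax K 1). intros n.
  assert (Hp : 0 < eps ^ n) by (apply pow_lt; lra).
  destruct (Nat.le_gt_cases n N) as [Hn|Hn].
  - apply Rle_trans with (K * eps ^ n).
    + specialize (HK n Hn). apply (Rmult_le_compat_r (eps ^ n)) in HK; [|lra].
      replace (u n / eps ^ n * eps ^ n) with (u n) in HK by (field; lra). exact HK.
    + apply Rmult_le_compat_r; [lra|apply Rmax_l].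
  - apply Rle_trans with (1 * eps ^ n); [|apply Rmult_le_compat_r; [lra|apply Rmax_r]].
    specialize (HN n ltac:(lia)). unfold nroot in HN. rewrite Rplus_0_l in HN.
    rewrite Rmult_1_l. destruct (Req_EM_T (u n) 0) as [E|E]; [lra|].
    assert (Hu : 0 < u n) by (specialize (u0 n); lra).
    rewrite <- (Rpower_1 (u n)) by exact Hu.
    replace 1 with (/ INR n * INR n) by (field; apply not_0_INR; lia).
    rewrite <- Rpower_mult, Rpower_pow by apply exp_pos.
    apply pow_incr. split; [left; apply exp_pos|lra].
Qed.

(** * Exponentials of real multiples and equality of normal elements *)

Section Normal.
Context {A : CStarAlgebra}.
Implicit Types (a b h k : A) (t : R).

Lemma aexp_rscal_add t a b : (a * b = b * a)%A ->
  (aexp (t *: a) * aexp (t *: b))%A = aexp (t *: (a + b))%A.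
Proof.
  intros H. rewrite smul_add. apply aexp_add. now rewrite !rscal_mul_rscal, H.
Qed.

Lemma aexp_rscal_double t h : (aexp (t *: h) * aexp (t *: h))%A = aexp ((2 * t)%R *: h)%A.
Proof.
  rewrite aexp_rscal_add, smul_add, <- rscal_addl by reflexivity.
  do 3 f_equal. ring.
Qed.

Lemma star_aexp_rscal t h : star (aexp (t *: h)%A) = aexp (t *: star h)%A.
Proof. now rewrite star_aexp, star_rscal. Qed.

Lemma rscal_opp_swap t h : ((- t)%R *: (- h))%A = (t *: h)%A.
Proof. rewrite rscal_N, smul_opp. nc_ring. Qed.

Lemma aexp_rscal_opp_r t h : (aexp (t *: h) * aexp (t *: (- h)))%A = 1%A.
Proof. rewrite smul_opp. apply aexp_opp_r. Qed.

Lemma aexp_rscal_opp_l t h : (aexp (t *: (- h)) * aexp (t *: h))%A = 1%A.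
Proof. rewrite smul_opp. apply aexp_opp_l. Qed.

(** In the proof [q t] is [p (- t)] and also the inverse of [p t]. Their slopes at 0 are 2(h - k)
    and 2(k - h), so [p = q] forces [h = k]. *)
Lemma eq_of_contractions h k : star h = h -> star k = k ->
  (forall t, norm (aexp (t *: h) * aexp (t *: (- k)))%A <= 1) -> h = k.
Proof.
  intros Hh Hk H.
  set (p := fun t => (aexp (t *: (- k)) * (aexp (t *: h) * aexp (t *: h))
                      * aexp (t *: (- k)))%A).
  set (q := fun t => (aexp (t *: k) * (aexp (t *: (- h)) * aexp (t *: (- h)))
                      * aexp (t *: k))%A).
  assert (Np : forall t, norm (p t) <= 1).
  { intros t. replace (p t) with
      (star (aexp (t *: h) * aexp (t *: (- k))) * (aexp (t *: h) * aexp (t *: (- k))))%A.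
    - rewrite <- (Rmult_1_l 1). apply norm_mul_le; [rewrite norm_star|]; apply H.
    - unfold p. rewrite star_mul, !star_aexp_rscal, star_opp, Hh, Hk. nc_ring. }
  assert (Nq : forall t, norm (q t) <= 1).
  { intros t. pose proof (H (- t)) as Ht.
    rewrite rscal_opp_swap in Ht.
    replace ((- t)%R *: h)%A with (t *: (- h))%A in Ht by now rewrite rscal_N, smul_opp.
    replace (q t) with
      (star (aexp (t *: (- h)) * aexp (t *: k)) * (aexp (t *: (- h)) * aexp (t *: k)))%A.
    - rewrite <- (Rmult_1_l 1). apply norm_mul_le; [rewrite norm_star|]; exact Ht.
    - unfold q. rewrite star_mul, !star_aexp_rscal, star_opp, Hh, Hk. nc_ring. }
  assert (mul_inverse : forall x x' y y' : A, (x * x' = 1)%A -> (y * y' = 1)%A ->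
    (x * y * (y' * x'))%A = 1%A).
  { intros x x' y y' Hx Hy. replace (x * y * (y' * x'))%A with (x * (y * y') * x')%A by nc_ring.
    now rewrite Hy, mul_1r. }
  assert (Epq : forall t, p t = q t).
  { intros t. apply selfadjoint_contraction_inverse; auto; unfold p, q.
    - rewrite !star_mul, !star_aexp_rscal, star_opp, Hh, Hk. nc_ring.
    - rewrite !star_mul, !star_aexp_rscal, star_opp, Hh, Hk. nc_ring.
    (* Reassociating the second factor gives the nested form [x * y * (y' * x')], in which inverses
       cancel from the middle outwards. *)
    - rewrite <- (mul_assoc A (aexp (t *: k)%A)).
      repeat apply mul_inverse; auto using aexp_rscal_opp_l, aexp_rscal_opp_r.
    - rewrite <- (mul_assoc A (aexp (t *: (- k))%A)).
      repeat apply mul_inverse; auto using aexp_rscal_opp_l, aexp_rscal_opp_r. }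
  assert (Hp : expands p (- k + (h + h) + - k)%A)
    by (repeat apply expands_mul; apply expands_aexp).
  assert (Hq : expands p (k + (- h + - h) + k)%A).
  { assert (Hq : expands q (k + (- h + - h) + k)%A)
      by (repeat apply expands_mul; apply expands_aexp).
    destruct Hq as [K HK]. exists K. intros t Ht. rewrite Epq. auto. }
  pose proof (expands_unique _ _ _ Hp Hq) as E.
  apply (rscal_inj 4); [lra|].
  replace 4 with (1 + 1 + 1 + 1) by ring. rewrite !rscal_addl, !rscal_1.
  apply sub_eq0.
  replace (h + h + h + h - (k + k + k + k))%A
    with (- k + (h + h) + - k - (k + (- h + - h) + k))%A by nc_ring.
  rewrite E. apply add_opp.
Qed.

Lemma rscal_half_double a : ((1 / 2)%R *: a + (1 / 2)%R *: a)%A = a.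
Proof.
  rewrite <- rscal_addl. replace (1 / 2 + 1 / 2) with 1 by field. apply rscal_1.
Qed.

(* The polar decomposition of [exp (t a)] has modulus [exp (t h)], so passing from [a], [b]
   to [h], [k] does not change the norm of the product. *)
Lemma real_parts_eq a b : is_normal a -> is_normal b ->
  subexponential (fun n => norm (Cab a b n)) -> (a + star a)%A = (b + star b)%A.
Proof.
  intros Ha Hb Hab.
  set (h := ((1 / 2)%R *: (a + star a))%A). set (k := ((1 / 2)%R *: (b + star b))%A).
  assert (Hhh : (h + h)%A = (a + star a)%A) by apply rscal_half_double.
  assert (Hkk : (k + k)%A = (b + star b)%A) by apply rscal_half_double.
  assert (Hh : star h = h).
  { unfold h. rewrite star_rscal, star_add, star_invol. f_equal. apply add_comm. }
  assert (Hk : star k = k).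
  { unfold k. rewrite star_rscal, star_add, star_invol. f_equal. apply add_comm. }
  enough (h = k) as E by (now rewrite <- Hhh, <- Hkk, E).
  apply eq_of_contractions; [assumption..|].
  assert (Hk' : star (- k)%A = (- k)%A) by now rewrite star_opp, Hk.
  apply le_1_of_doubling.
  - intros t. apply norm_ge0.
  - intros t. rewrite <- !aexp_rscal_double.
    apply norm_mul_sqr_le; rewrite star_aexp_rscal; congruence.
  - intros eps He. destruct (Hab eps He) as [K HK]. exists K. intros t.
    rewrite <- (norm_mul_abs (aexp (t *: a)%A) (aexp (t *: (- b))%A)).
    + apply norm_aexp_mul_le; [lra|exact HK].
    (* Normality merges the exponentials of [t *: star a] and [t *: a]; the sum of the exponents is
       [t *: (h + h)]. *)
    + rewrite !star_aexp_rscal, Hh, !aexp_rscal_add, Hhh by (reflexivity || now rewrite Ha).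
      now rewrite add_comm.
    + rewrite !star_aexp_rscal, Hk', !aexp_rscal_add.
      * do 2 f_equal. rewrite star_opp.
        replace (- k + - k)%A with (- (k + k))%A by nc_ring. rewrite Hkk. nc_ring.
      * reflexivity.
      * rewrite star_opp. replace (- b * - star b)%A with (b * star b)%A by nc_ring.
        rewrite Hb. nc_ring.
Qed.

Lemma normal_eq a b : is_normal a -> is_normal b ->
  subexponential (fun n => norm (Cab a b n)) -> a = b.
Proof.
  intros Ha Hb Hab.
  set (i := (0, 1) : Cx).
  assert (Hi : Cmod i = 1).
  { rewrite <- sqrt_1. unfold Cmod, i; simpl. f_equal. ring. }
  assert (Hnormal : forall x : A, is_normal x -> is_normal (smul i x)).
  { intros x Hx. unfold is_normal. rewrite star_smul, !smul_mul_smul, Hx, Cmul_comm.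
    reflexivity. }
  assert (Hstar : forall x : A, (smul i x + star (smul i x) = smul i (x - star x))%A).
  { intros x. rewrite smul_add, smul_opp, star_smul, (opp_rscal (smul i _)), smul_assoc.
    do 2 f_equal. unfold Cmul, RtoC, Cconj, i; simpl. f_equal; ring. }
  pose proof (real_parts_eq a b Ha Hb Hab) as Hre.
  assert (Him : (a - star a = b - star b)%A).
  { apply (smul_inj i (0, -1)).
    - unfold Cmul, Cone, i; simpl. f_equal; ring.
    (* Up to the factor [i], the skew-adjoint part of [a] is the real part of [smul i a]; the powers
       of [i] have modulus 1, so the growth hypothesis carries over. *)
    - rewrite <- !Hstar. apply real_parts_eq; auto.
      intros eps He. destruct (Hab eps He) as [K HK]. exists K. intros n.
      rewrite Cab_smul, norm_smul, Cmod_pow, Hi, pow1, Rmult_1_l. apply HK. }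
  apply (rscal_inj 2); [lra|]. replace 2 with (1 + 1) by ring.
  rewrite !rscal_addl, !rscal_1.
  replace (a + a)%A with (a + star a + (a - star a))%A by nc_ring.
  rewrite Hre, Him. nc_ring.
Qed.

(** All products collapse to [apow a (S n)], and the coefficients add up to [(-1 + 1) ^ S n]. In
    degree 0 the value is [one] instead. *)
Lemma Cab_diag a n : Cab a a (S n) = 0%A.
Proof.
  unfold Cab.
  rewrite (asum_ext _ (fun j => ((-1) ^ j * Binomial.C (S n) j)%R *: apow a (S n))%A).
  2:{ intros j Hj. rewrite <- apow_add. do 2 f_equal. lia. }
  rewrite asum_rscall.
  rewrite (sum_eq _ (fun j => Binomial.C (S n) j * (-1) ^ j * 1 ^ (S n - j))).
  2:{ intros j _. rewrite pow1. ring. }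
  rewrite <- binomial. replace (-1 + 1) with 0 by ring.
  rewrite pow_i by lia. apply rscal_0.
Qed.

Lemma rho_diag a : rho_is a a 0.
Proof.
  assert (H : forall n, (n >= 1)%nat -> nroot (norm (Cab a a n)) n = 0).
  { intros [|n] Hn; [lia|]. rewrite Cab_diag, norm_0. unfold nroot.
    destruct (Req_EM_T 0 0); [reflexivity|contradiction]. }
  intros eps He. split.
  - exists 1%nat. intros n Hn. rewrite H by exact Hn. lra.
  - intros N. exists (S N). split; [lia|]. rewrite H by lia. lra.
Qed.

End Normal.

(** The condition that d_rho(a,b) is 0 is spelled out as the vanishing of both limits superior:
    these are nonnegative, so their maximum is 0 exactly when both are. *)
Theorem theorem3p4 (A : CStarAlgebra) (a b : A) :
  is_normal a -> is_normal b ->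
  (a = b <-> rho_is a b 0) /\
  (a = b <-> (rho_is a b 0 /\ rho_is b a 0)).
Proof.
  intros Ha Hb.
  assert (H : rho_is a b 0 -> a = b).
  { intros Hrho. apply normal_eq; [assumption..|].
    apply limsup_nroot_subexponential; [intros n; apply norm_ge0|exact Hrho]. }
  split; split.
  - intros <-. apply rho_diag.
  - exact H.
  - intros <-. split; apply rho_diag.
  - intros [Hrho _]. exact (H Hrho).
Qed.
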